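(* Let $a>0$ and $b>0$ be real, and let $g(t)=\dfrac{1}{a^2+\sinh(bt)^2}$ for $t\in\mathbb{R}$. Then the Fourier transform $\hat g(k)=\int_{-\infty}^{\infty}e^{ikt}g(t)\,\mathrm{d}t$ is given, for real $k$, by $$\hat{g}(k) = \frac{2\pi\cosh\left(\frac{k\pi}{2b}\right)}{ab\sinh\left(\frac{k\pi}{b}\right)}\cdot\frac{\sinh\left(\frac{k}{b}\arccos(a)\right)}{\sqrt{1-a^2}},$$ where the principal branches of the inverse cosine and of the square root are taken, and where for $k=0$ or $a=1$ the right-hand side is understood as its limiting value (extension by continuity).
   Context: The principal branches are: $\sqrt{z}$ with $\sqrt{1-a^2}=i\sqrt{a^2-1}$ for $a>1$, and $\arccos(z)=-i\,\mathrm{Log}\left(z+i\sqrt{1-z^2}\right)$ with $\mathrm{Log}$ the principal logarithm; thus $\arccos(a)\in[0,\pi/2)$ for $0<a\le 1$ and $\arccos(a)=i\ln\left(a+\sqrt{a^2-1}\right)$ for $a>1$. *)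

(* Defs.v *)
From Stdlib Require Import Reals.
From Coquelicot Require Import Coquelicot.

Open Scope R_scope.

Definition Cexp (z : C) : C :=
  (exp (Re z) * cos (Im z), exp (Re z) * sin (Im z)).

Definition Csinh (z : C) : C := ((Cexp z - Cexp (- z)) / 2)%C.

(* Principal argument, with values in (-PI, PI] for z <> 0; the negative reals
   get argument PI. Only z <> 0 is meaningful. *)
Definition Carg (z : C) : R :=
  if Rle_dec 0 (Im z) then acos (Re z / Cmod z) else - acos (Re z / Cmod z).

Definition Clog (z : C) : C := (ln (Cmod z), Carg z).

(* sqrt |z| * exp (i arg z / 2): equal to exp (Log z / 2) for z <> 0, and to 0
   at z = 0. In particular Csqrt (1 - a^2) = i sqrt (a^2 - 1) for real a > 1. *)
Definition Csqrt (z : C) : C :=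
  (RtoC (sqrt (Cmod z)) * Cexp (Ci * RtoC (Carg z / 2)))%C.

Definition Cacos (z : C) : C :=
  (- Ci * Clog (z + Ci * Csqrt (1 - z * z)))%C.

(* l is the integral of exp (i k t) f t over the real line; the two ends of the
   improper integral tend to infinity independently. *)
Definition is_fourier (f : R -> R) (k : R) (l : C) : Prop :=
  is_RInt_gen (V := C_R_NormedModule)
    (fun t : R => (Cexp (Ci * RtoC k * RtoC t) * RtoC (f t))%C)
    (Rbar_locally m_infty) (Rbar_locally p_infty) l.

Definition g (a b t : R) : R := / (a ^ 2 + sinh (b * t) ^ 2).

(* Meaningful only for k <> 0 and a <> 1, where no denominator vanishes. *)
Definition ghat_formula (b a k : R) : C :=
  (RtoC (2 * PI * cosh (k * PI / (2 * b)) / (a * b * sinh (k * PI / b)))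
   * (Csinh (RtoC (k / b) * Cacos (RtoC a))
      / Csqrt (1 - RtoC a * RtoC a)))%C.

Definition regular (p : R * R) : Prop :=
  0 < fst p /\ fst p <> 1 /\ snd p <> 0.

(* Main.v *)
Require Import Defs.
From Stdlib Require Import Reals Lra Psatz.
From Coquelicot Require Import Coquelicot.

Open Scope R_scope.

(** The substitution [u = b * t] reduces everything to the integrals over the
    real line

      G n w A  =  int cos (w u) / (A + sinh^2 u)^n du,    A = a^2,  w = k / b;

    the sine part of the Fourier integral vanishes by parity.  No contour is
    moved: the integral [G 1] is found from a differential equation in the
    parameter [A].

    Differentiation under the integral gives [G 1' = - G 2] and
    [G 2' = - 2 G 3], and integrating the second derivative of
    [1 / (A + sinh^2 u)] by parts against [cos (w u)] gives a linear relation
    between [G 1], [G 2] and [G 3] ([G_recurrence]): a second order equation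
    for [A |-> G 1 w A].  It becomes an equation with constant coefficients in
    the angle.  With [A = cos^2 th], the function
    [H th = sin th * cos th * G 1 w (cos^2 th)] satisfies [H'' = w^2 H],
    [H 0 = 0], [H' 0 = G 1 w 1], so that [H th = G 1 w 1 * sinh (w th) / w]; with
    [A = cosh^2 eta] the same computation gives [H'' = - w^2 H] and a sine
    ([G1_closed_form] treats both at once).  These are the branches [a < 1]
    and [a > 1] of the formula, [th] or [i eta] being the principal
    [arccos a].

    The remaining constant [G 1 w 1] comes from the limit [th -> pi/2], where
    the kernel [sin th cos th / (cos^2 th + sinh^2 u)] tends to [pi] times a
    Dirac mass: replacing [cos (w u)] by [1] changes [H th] by
    [O (sin th cos th)], and for [w = 0] an explicit primitive gives
    [H th = 2 th].  Hence [G 1 w 1 * sinh (w pi/2) / w = pi] ([G1_at_one]).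

    In the degenerate cases [k = 0] or [a = 1] the limit needs no computation:
    [G 1] is jointly continuous in [(w, A)], so the formula, which equals the
    integral at all regular parameters, tends to the integral at the
    degenerate one ([G1_continuous]).

    All convergence rests on comparison with [1 / cosh u], whose integral is
    [pi]. *)

(** * Hyperbolic functions *)

Lemma cosh_sinh_sqr (u : R) : cosh u ^ 2 = 1 + sinh u ^ 2.
Proof.
  assert (h : exp u * exp (- u) = 1) by (rewrite <- exp_plus, Rplus_opp_r; apply exp_0).
  unfold cosh, sinh. nra.
Qed.

Lemma cosh_ge_1 (u : R) : 1 <= cosh u.
Proof.
  assert (0 < cosh u) by (unfold cosh; generalize (exp_pos u), (exp_pos (- u)); lra).
  generalize (cosh_sinh_sqr u), (pow2_ge_0 (sinh u)). nra.
Qed.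

Lemma cosh_even (u : R) : cosh (- u) = cosh u.
Proof. unfold cosh. rewrite Ropp_involutive. lra. Qed.

Lemma sinh_odd (u : R) : sinh (- u) = - sinh u.
Proof. unfold sinh. rewrite Ropp_involutive. lra. Qed.

Lemma Rabs_le_sinh (u : R) : Rabs u <= 2 * Rabs (sinh u).
Proof.
  assert (pos : forall v, 0 <= v -> v <= 2 * sinh v).
  { intros v hv. generalize (exp_ineq1_le v). intro h1.
    assert (h : exp v * exp (- v) = 1) by (rewrite <- exp_plus, Rplus_opp_r; apply exp_0).
    generalize (exp_pos (- v)). intro h2. unfold sinh.
    assert (exp (- v) <= 1) by nra. lra. }
  destruct (Rle_dec 0 u) as [hu | hu].
  - rewrite (Rabs_pos_eq u) by lra. generalize (pos u hu), (Rle_abs (sinh u)). lra.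
  - rewrite <- Rabs_Ropp, (Rabs_pos_eq (- u)) by lra.
    rewrite <- (Rabs_Ropp (sinh u)), <- sinh_odd.
    assert (hv : 0 <= - u) by lra. generalize (pos _ hv), (Rle_abs (sinh (- u))). lra.
Qed.

Lemma Rabs_le_cosh (u : R) : Rabs u <= 2 * cosh u.
Proof.
  apply Rle_trans with (1 := Rabs_le_sinh u).
  generalize (cosh_ge_1 u), (cosh_sinh_sqr u). intros h1 h2.
  unfold Rabs; destruct Rcase_abs; nra.
Qed.

(** * Integrals over the real line *)

Notation line_int f l :=
  (is_RInt_gen f (Rbar_locally m_infty) (Rbar_locally p_infty) l).

Notation line_integral f :=
  (RInt_gen f (Rbar_locally m_infty) (Rbar_locally p_infty)).

Lemma sech_decay_lim (f : R -> R) (C : R) (x : Rbar) :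
  x = m_infty \/ x = p_infty ->
  (forall u, Rabs (f u) <= C / cosh u) -> filterlim f (Rbar_locally x) (locally 0).
Proof.
  intros hx hf.
  apply filterlim_locally. intros eps.
  set (M := (2 * Rabs C + 1) / eps).
  assert (he := cond_pos eps).
  assert (hM : 0 < M) by (unfold M; apply Rdiv_lt_0_compat; generalize (Rabs_pos C); lra).
  assert (far : forall u, M < Rabs u -> ball 0 eps (f u)).
  { intros u hu. change (Rabs (f u - 0) < eps). rewrite Rminus_0_r.
    apply Rle_lt_trans with (1 := hf u).
    generalize (cosh_ge_1 u), (Rabs_le_cosh u). intros h1 h2.
    apply (Rmult_lt_reg_r (cosh u)); [lra |].
    unfold Rdiv. rewrite Rmult_assoc, Rinv_l, Rmult_1_r by lra.
    assert (hMe : M * eps = 2 * Rabs C + 1) by (unfold M; field; lra).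
    generalize (Rle_abs C). nra. }
  destruct hx as [-> | ->]; simpl.
  - exists (- M). intros u hu. apply far. rewrite Rabs_left; lra.
  - exists M. intros u hu. apply far. rewrite Rabs_right; lra.
Qed.

Lemma filter_line_le :
  filter_prod (Rbar_locally m_infty) (Rbar_locally p_infty)
    (fun ab : R * R => fst ab <= snd ab).
Proof.
  apply (Filter_prod _ _ _ (fun a => a < 0) (fun b => 0 < b)).
  - exists 0. auto.
  - exists 0. auto.
  - simpl. intros. lra.
Qed.

Lemma line_int_derive (F f : R -> R) (la lb : R) :
  (forall u, is_derive F u (f u)) -> (forall u, continuous f u) ->
  filterlim F (Rbar_locally m_infty) (locally la) ->
  filterlim F (Rbar_locally p_infty) (locally lb) ->
  line_int f (lb - la).
Proof.
  intros hF hf hla hlb.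
  assert (hD : forall u, Derive F u = f u) by (intro; apply is_derive_unique, hF).
  apply is_RInt_gen_ext with (Derive F).
  { apply filter_forall. intros ab u _. apply hD. }
  apply is_RInt_gen_Derive; auto; apply filter_forall; intros ab u _.
  - eexists; apply hF.
  - apply continuous_ext with (2 := hf u). intro; symmetry; apply hD.
Qed.

Lemma atan_lim_p : filterlim atan (Rbar_locally p_infty) (locally (PI / 2)).
Proof.
  apply filterlim_locally. intros eps.
  assert (he := cond_pos eps). assert (hpi := PI_RGT_0).
  set (d := Rmin eps (PI / 2)).
  assert (hd : 0 < d <= PI / 2 /\ d <= eps).
  { unfold d. repeat split. apply Rmin_glb_lt; lra. apply Rmin_r. apply Rmin_l. }
  exists (tan (PI / 2 - d)). intros y hy.
  change (Rabs (atan y - PI / 2) < eps).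
  generalize (atan_bound y). intro hb.
  apply atan_increasing in hy. rewrite atan_tan in hy by lra.
  apply Rabs_def1; lra.
Qed.

Lemma sinh_lim_p : filterlim sinh (Rbar_locally p_infty) (Rbar_locally p_infty).
Proof.
  intros P [M hM]. exists (2 * Rabs M). intros u hu. apply hM.
  generalize (Rabs_le_sinh u), (Rabs_pos M), (Rle_abs M). intros h1 h2 h3.
  rewrite (Rabs_right u) in h1 by lra.
  assert (0 < sinh u) by (rewrite <- sinh_0; apply sinh_lt; lra).
  rewrite (Rabs_right (sinh u)) in h1 by lra. lra.
Qed.

Lemma opp_lim_m : filterlim Ropp (Rbar_locally m_infty) (Rbar_locally p_infty).
Proof. intros P [M hM]. exists (- M). intros u hu. apply hM. lra. Qed.

Lemma odd_lim_m (f : R -> R) (l : R) :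
  (forall u, f (- u) = - f u) ->
  filterlim f (Rbar_locally p_infty) (locally l) ->
  filterlim f (Rbar_locally m_infty) (locally (- l)).
Proof.
  intros hodd hl.
  apply filterlim_ext with (fun u => - f (- u)).
  { intro u. rewrite hodd. ring. }
  apply filterlim_comp with (2 := filterlim_opp l).
  apply filterlim_comp with (1 := opp_lim_m). exact hl.
Qed.

(** The Gudermannian function. *)
Lemma is_derive_gd (u : R) : is_derive (fun u => atan (sinh u)) u (/ cosh u).
Proof.
  generalize (cosh_ge_1 u), (cosh_sinh_sqr u). intros h1 h2.
  auto_derive; auto.
  replace (1 + sinh u * (sinh u * 1)) with (cosh u * cosh u) by nra. field. lra.
Qed.

Lemma continuous_sech (u : R) : continuous (fun u => / cosh u) u.
Proof.
  apply (ex_derive_continuous (V := R_NormedModule)). auto_derive. generalize (cosh_ge_1 u). lra.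
Qed.

Lemma line_int_sech : line_int (fun u => / cosh u) PI.
Proof.
  assert (hp : filterlim (fun u => atan (sinh u)) (Rbar_locally p_infty) (locally (PI / 2))).
  { apply filterlim_comp with (1 := sinh_lim_p), atan_lim_p. }
  replace PI with (PI / 2 - - (PI / 2)) by lra.
  apply line_int_derive with (fun u => atan (sinh u)); auto.
  - apply is_derive_gd.
  - apply continuous_sech.
  - apply odd_lim_m with (2 := hp). intro u. rewrite sinh_odd. apply atan_opp.
Qed.

Lemma line_int_unique (f : R -> R) (l : R) : line_int f l -> line_integral f = l.
Proof. apply (is_RInt_gen_unique (V := R_CompleteNormedModule)). Qed.

Lemma line_int_sech_bound (f : R -> R) (C l : R) :
  (forall u, Rabs (f u) <= C / cosh u) -> line_int f l -> Rabs l <= C * PI.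
Proof.
  intros hf hl.
  apply (RInt_gen_norm (V := R_CompleteNormedModule)
    (Fa := Rbar_locally m_infty) (Fb := Rbar_locally p_infty)
    f (fun u => C / cosh u) l (C * PI)); auto.
  - apply filter_line_le.
  - apply filter_forall. intros ab u _. apply hf.
  - apply (is_RInt_gen_scal (V := R_NormedModule) (fun u => / cosh u) C PI line_int_sech).
Qed.

(** The integrals over windows [[a, b]] are Cauchy because each of them is at
    most the increment of [C * atan (sinh u)], a primitive of [C / cosh u] with
    finite limits at both ends. *)
Lemma sech_dominated_ex (f : R -> R) (C : R) :
  (forall u, continuous f u) -> (forall u, Rabs (f u) <= C / cosh u) ->
  ex_RInt_gen f (Rbar_locally m_infty) (Rbar_locally p_infty).
Proof.
  intros hc hf.
  assert (exf : forall a b, ex_RInt f a b).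
  { intros a b. apply (ex_RInt_continuous (V := R_CompleteNormedModule)). auto. }
  (* a primitive of the majorant, bounded on the whole line *)
  set (gd := fun u => C * atan (sinh u)).
  assert (dgd : forall u, is_derive gd u (C / cosh u)).
  { intro u. apply (is_derive_scal (fun u => atan (sinh u)) u C (/ cosh u)), is_derive_gd. }
  assert (cgd : forall u, continuous (fun u => C / cosh u) u).
  { intro u. apply (continuous_scal_r (V := R_NormedModule) C (fun u => / cosh u)), continuous_sech. }
  assert (bnd : forall a b, a <= b -> Rabs (RInt f a b) <= gd b - gd a).
  { intros a b hab.
    apply (norm_RInt_le (V := R_NormedModule) f (fun u => C / cosh u) a b);
      [exact hab | intros; apply hf | |].
    - apply (RInt_correct (V := R_CompleteNormedModule)); auto.
    - apply (is_RInt_derive (V := R_CompleteNormedModule) gd); auto. }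
  assert (bnd' : forall a b, Rabs (RInt f a b) <= Rabs (gd b - gd a)).
  { intros a b. destruct (Rle_dec a b) as [hab | hab].
    - apply Rle_trans with (1 := bnd a b hab), Rle_abs.
    - rewrite <- (opp_RInt_swap (V := R_CompleteNormedModule)) by auto.
      unfold opp; simpl. rewrite Rabs_Ropp, Rabs_minus_sym.
      apply Rle_trans with (2 := Rle_abs _), bnd. lra. }
  assert (lp : filterlim gd (Rbar_locally p_infty) (locally (C * (PI / 2)))).
  { apply (filterlim_comp _ _ _ (fun u => atan (sinh u)) (fun v => C * v) _ (locally (PI / 2))).
    - apply filterlim_comp with (1 := sinh_lim_p), atan_lim_p.
    - apply (filterlim_scal_r (V := R_NormedModule) C). }
  assert (lm : filterlim gd (Rbar_locally m_infty) (locally (- (C * (PI / 2))))).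
  { apply odd_lim_m with (2 := lp). intro u. unfold gd. rewrite sinh_odd, atan_opp. ring. }
  assert (cauchy : exists l : R, filterlim (fun ab : R * R => RInt f (fst ab) (snd ab))
     (filter_prod (Rbar_locally m_infty) (Rbar_locally p_infty)) (locally l)).
  { apply (filterlim_locally_cauchy (U := R_CompleteSpace)). intros eps.
    assert (he := cond_pos eps).
    assert (h4 : 0 < eps / 4) by lra.
    generalize (proj1 (filterlim_locally _ _) lp (mkposreal _ h4)). intro hp.
    generalize (proj1 (filterlim_locally _ _) lm (mkposreal _ h4)). intro hm.
    exists (fun ab => ball (- (C * (PI / 2))) (eps / 4) (gd (fst ab)) /\
                      ball (C * (PI / 2)) (eps / 4) (gd (snd ab))).
    split.
    { apply (Filter_prod _ _ _ _ _ hm hp). simpl. auto. }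
    intros [a b] [a' b'] [h1 h2] [h3 h4']. simpl in *.
    change (Rabs (gd a - - (C * (PI / 2))) < eps / 4) in h1.
    change (Rabs (gd a' - - (C * (PI / 2))) < eps / 4) in h3.
    change (Rabs (gd b - (C * (PI / 2))) < eps / 4) in h2.
    change (Rabs (gd b' - (C * (PI / 2))) < eps / 4) in h4'.
    change (Rabs (RInt f a' b' - RInt f a b) < eps).
    replace (RInt f a' b' - RInt f a b) with (RInt f a' a + RInt f b b').
    2:{ rewrite <- (RInt_Chasles (V := R_CompleteNormedModule) f a' a b') by auto.
        rewrite <- (RInt_Chasles (V := R_CompleteNormedModule) f a b b') by auto.
        unfold plus; simpl. ring. }
    apply Rle_lt_trans with (1 := Rabs_triang _ _).
    generalize (bnd' a' a), (bnd' b b'). intros h5 h6.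
    apply Rabs_def2 in h1, h2, h3, h4'.
    assert (Rabs (gd a - gd a') < eps / 2) by (apply Rabs_def1; lra).
    assert (Rabs (gd b' - gd b) < eps / 2) by (apply Rabs_def1; lra).
    lra. }
  destruct cauchy as [l hl]. exists l.
  apply (filterlimi_lim_ext (fun ab => RInt f (fst ab) (snd ab))); auto.
  intros ab. apply (RInt_correct (V := R_CompleteNormedModule)); auto.
Qed.

Lemma sech_dominated_int (f : R -> R) (C : R) :
  (forall u, continuous f u) -> (forall u, Rabs (f u) <= C / cosh u) ->
  line_int f (line_integral f).
Proof.
  intros hc hf.
  apply (RInt_gen_correct (V := R_CompleteNormedModule)), sech_dominated_ex with C; auto.
Qed.

(** The integral exists, so its value is the limit along symmetric windows,
    over which an odd function integrates to zero. *)
Lemma line_int_odd (f : R -> R) (l : R) :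
  (forall u, f (- u) = - f u) -> (forall u, continuous f u) -> line_int f l -> l = 0.
Proof.
  intros hodd hc hl.
  assert (exf : forall a b, ex_RInt f a b).
  { intros a b. apply (ex_RInt_continuous (V := R_CompleteNormedModule)). auto. }
  assert (sym : forall x, is_RInt f (- x) x 0).
  { intro x. generalize (RInt_correct (V := R_CompleteNormedModule) f _ _ (exf (- x) x)). intro h.
    assert (h' : is_RInt f x (- x) (RInt f (- x) x)).
    { apply is_RInt_ext with (fun y => opp (f (- y))).
      - intros y _. rewrite hodd. unfold opp; simpl. ring.
      - apply (is_RInt_comp_opp f). rewrite Ropp_involutive. exact h. }
    apply (is_RInt_unique (V := R_CompleteNormedModule)) in h'.
    rewrite <- (opp_RInt_swap (V := R_CompleteNormedModule)) in h' by auto.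
    unfold opp in h'; simpl in h'.
    replace 0 with (RInt f (- x) x) by lra. exact h. }
  apply eq_sym.
  apply (filterlimi_locally_unique (V := R_NormedModule) (F := Rbar_locally p_infty)
     (fun x => is_RInt f (- x) x)).
  - apply filter_forall. intros x y1 y2 h1 h2.
    rewrite <- (is_RInt_unique (V := R_CompleteNormedModule) _ _ _ _ h1).
    apply (is_RInt_unique (V := R_CompleteNormedModule) _ _ _ _ h2).
  - apply (filterlimi_lim_ext (fun _ => 0)); [exact sym | apply filterlim_const].
  - apply (filterlimi_comp_2 (fun x => - x) (fun x => x) (is_RInt f)) with (3 := hl).
    + intros P [M hM]. exists (- M). intros u hu. apply hM. lra.
    + apply filterlim_id.
Qed.

(** * The kernel and its domination *)

Definition kernel (n : nat) (w A u : R) : R := cos (w * u) / (A + sinh u ^ 2) ^ n.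

(** Only the powers [n = 1, 2, 3] occur: up to factors, [G 2] and [G 3] are the
    first two derivatives of [G 1] in [A]. *)
Definition G (n : nat) (w A : R) : R := line_integral (kernel n w A).

(** For [m <= A] one has [A + sinh^2 u >= min 1 m * cosh^2 u]; the inverse of this
    minimum is the constant in all estimates that are uniform in [A >= m]. *)
Definition kernel_cst (m : R) : R := / Rmin 1 m.

Lemma cst_pos (m : R) : 0 < m -> 0 < kernel_cst m.
Proof. intro hm. apply Rinv_0_lt_compat, Rmin_glb_lt; lra. Qed.

Lemma inv_shift_bound (m A u : R) :
  0 < m -> m <= A -> 0 < / (A + sinh u ^ 2) <= kernel_cst m * / cosh u ^ 2.
Proof.
  intros hm hA.
  generalize (cosh_ge_1 u), (cosh_sinh_sqr u), (pow2_ge_0 (sinh u)). intros h1 h2 h3.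
  split; [apply Rinv_0_lt_compat; lra |].
  unfold kernel_cst. rewrite <- Rinv_mult.
  assert (h4 : 0 < Rmin 1 m) by (apply Rmin_glb_lt; lra).
  apply Rinv_le_contravar; [nra |].
  generalize (Rmin_l 1 m), (Rmin_r 1 m). nra.
Qed.

Lemma sech_sqr_le_1 (u : R) : 0 < / cosh u ^ 2 <= 1.
Proof.
  generalize (cosh_ge_1 u). intro h1.
  split; [apply Rinv_0_lt_compat; nra |].
  rewrite <- Rinv_1. apply Rinv_le_contravar; nra.
Qed.

Lemma sech_sqr_le (u : R) : / cosh u ^ 2 <= / cosh u.
Proof. generalize (cosh_ge_1 u). intro h1. apply Rinv_le_contravar; nra. Qed.

Lemma inv_shift_pow_bound (n : nat) (m A u : R) :
  0 < m -> m <= A -> 0 < / (A + sinh u ^ 2) ^ S n <= kernel_cst m ^ S n * / cosh u ^ 2.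
Proof.
  intros hm hA. assert (hc := cst_pos m hm).
  assert (hb := inv_shift_bound m A u hm hA). assert (h1 := sech_sqr_le_1 u).
  rewrite <- pow_inv. split; [apply pow_lt; lra |].
  induction n as [|n IH].
  - rewrite !pow_1. lra.
  - assert (hp : 0 < (/ (A + sinh u ^ 2)) ^ S n) by (apply pow_lt; lra).
    assert (hq : 0 < kernel_cst m ^ S n) by (apply pow_lt; lra).
    rewrite <- (tech_pow_Rmult _ (S n)), <- (tech_pow_Rmult (kernel_cst m) (S n)).
    apply Rle_trans with ((kernel_cst m * / cosh u ^ 2) * (kernel_cst m ^ S n * / cosh u ^ 2)).
    + apply Rmult_le_compat; lra.
    + set (q := / cosh u ^ 2) in *. set (p := kernel_cst m ^ S n) in *.
      replace (kernel_cst m * q * (p * q)) with (kernel_cst m * p * (q * q)) by ring.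
      apply Rmult_le_compat_l; nra.
Qed.

Lemma inv_shift_pow_sech (n : nat) (m A u : R) :
  0 < m -> m <= A -> / (A + sinh u ^ 2) ^ S n <= kernel_cst m ^ S n / cosh u.
Proof.
  intros hm hA. apply Rle_trans with (1 := proj2 (inv_shift_pow_bound n m A u hm hA)).
  apply Rmult_le_compat_l; [left; apply pow_lt, cst_pos, hm | apply sech_sqr_le].
Qed.

Lemma Rabs_cos_le_1 (x : R) : Rabs (cos x) <= 1.
Proof. apply Rabs_le, COS_bound. Qed.

Lemma shift_quotient_bound (n : nat) (m A u c : R) :
  0 < m -> m <= A ->
  Rabs (c / (A + sinh u ^ 2) ^ S n) <= Rabs c * kernel_cst m ^ S n / cosh u.
Proof.
  intros hm hA. unfold Rdiv at 1. rewrite Rabs_mult.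
  rewrite (Rabs_pos_eq (/ _)) by (left; apply (inv_shift_pow_bound n m A u hm hA)).
  unfold Rdiv. rewrite Rmult_assoc. apply Rmult_le_compat_l; [apply Rabs_pos |].
  apply inv_shift_pow_sech; auto.
Qed.

Lemma continuous_kernel (n : nat) (w A u : R) : 0 < A -> continuous (kernel n w A) u.
Proof.
  intro hA. unfold kernel.
  apply (ex_derive_continuous (V := R_NormedModule)). auto_derive.
  apply pow_nonzero. generalize (pow2_ge_0 (sinh u)). simpl. lra.
Qed.

Lemma line_int_kernel (n : nat) (w A : R) :
  0 < A -> line_int (kernel (S n) w A) (G (S n) w A).
Proof.
  intro hA. apply sech_dominated_int with (kernel_cst A ^ S n).
  - intro u. apply continuous_kernel, hA.
  - intro u. unfold kernel. apply Rle_trans with (1 := shift_quotient_bound n A A u _ hA (Rle_refl A)).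
    apply Rmult_le_compat_r; [left; apply Rinv_0_lt_compat; generalize (cosh_ge_1 u); lra |].
    rewrite <- (Rmult_1_l (kernel_cst A ^ S n)) at 2.
    apply Rmult_le_compat_r; [left; apply pow_lt, cst_pos, hA | apply Rabs_cos_le_1].
Qed.

(** * Differentiation in the parameter *)

Lemma is_derive_quadratic (f : R -> R) (x d delta M : R) :
  0 < delta ->
  (forall y, Rabs (y - x) <= delta -> Rabs (f y - f x - (y - x) * d) <= M * (y - x) ^ 2) ->
  is_derive f x d.
Proof.
  intros hdelta hq. apply is_derive_Reals. intros eps heps.
  set (r := Rmin delta (eps / (Rabs M + 1))).
  assert (hM := Rabs_pos M).
  assert (h1 : 0 < eps / (Rabs M + 1)) by (apply Rdiv_lt_0_compat; lra).
  assert (hr : 0 < r) by (apply Rmin_glb_lt; lra).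
  exists (mkposreal r hr). intros h hh hb. simpl in hb.
  generalize (hq (x + h)). replace (x + h - x) with h by ring. intro hq'.
  assert (hb1 : Rabs h <= delta).
  { left. apply Rlt_le_trans with (1 := hb). apply Rmin_l. }
  assert (hb2 : Rabs h < eps / (Rabs M + 1)).
  { apply Rlt_le_trans with (1 := hb). apply Rmin_r. }
  specialize (hq' hb1).
  replace ((f (x + h) - f x) / h - d) with ((f (x + h) - f x - h * d) / h) by (field; auto).
  assert (ha : 0 < Rabs h) by (apply Rabs_pos_lt; auto).
  unfold Rdiv. rewrite Rabs_mult, Rabs_inv.
  apply (Rmult_lt_reg_r (Rabs h)); auto.
  rewrite Rmult_assoc, Rinv_l, Rmult_1_r by lra.
  apply Rle_lt_trans with (1 := hq').
  rewrite <- (pow2_abs h).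
  assert (h2 : Rabs h * (Rabs M + 1) < eps).
  { replace eps with (eps / (Rabs M + 1) * (Rabs M + 1)) by (field; lra).
    apply Rmult_lt_compat_r; lra. }
  generalize (Rle_abs M). nra.
Qed.

(** Differentiation under the integral sign in quantitative form: a second
    order Taylor bound dominated by [1 / cosh u] integrates to a second order
    Taylor bound.  For the rational kernels below the Taylor remainder is an
    explicit fraction. *)
Lemma is_derive_line_integral (F : R -> R -> R) (I : R -> R) (F1 : R -> R) (x d delta M : R) :
  0 < delta ->
  (forall y, Rabs (y - x) <= delta -> line_int (F y) (I y)) ->
  line_int F1 d ->
  (forall y u, Rabs (y - x) <= delta ->
     Rabs (F y u - F x u - (y - x) * F1 u) <= (M * (y - x) ^ 2) / cosh u) ->
  is_derive I x d.
Proof.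
  intros hdelta hI hd hq.
  apply is_derive_quadratic with delta (M * PI); auto.
  intros y hy.
  replace (M * PI * (y - x) ^ 2) with (M * (y - x) ^ 2 * PI) by ring.
  apply line_int_sech_bound with (fun u => F y u - F x u - (y - x) * F1 u); auto.
  apply (is_RInt_gen_minus (V := R_NormedModule) (fun u => F y u - F x u) (fun u => (y - x) * F1 u)).
  - apply (is_RInt_gen_minus (V := R_NormedModule) (F y) (F x)); auto.
    apply hI. rewrite Rminus_diag, Rabs_R0. lra.
  - apply (is_RInt_gen_scal (V := R_NormedModule) F1 (y - x)); auto.
Qed.

Lemma is_derive_G1 (w A : R) : 0 < A -> is_derive (G 1 w) A (- G 2 w A).
Proof.
  intro hA.
  apply is_derive_line_integral with (F := kernel 1 w) (F1 := fun u => - kernel 2 w A u)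
    (delta := A / 2) (M := kernel_cst (A / 2) ^ 3); [lra | | |].
  - intros y hy. apply Rabs_le_between in hy. apply line_int_kernel. lra.
  - apply (is_RInt_gen_opp (V := R_NormedModule) (kernel 2 w A)), line_int_kernel, hA.
  - intros y u hy. apply Rabs_le_between in hy. unfold kernel.
    assert (hm : 0 < A / 2) by lra.
    generalize (inv_shift_pow_bound 0 (A / 2) A u hm ltac:(lra)),
      (inv_shift_pow_bound 0 (A / 2) y u hm ltac:(lra)),
      (sech_sqr_le u), (sech_sqr_le_1 u), (cst_pos _ hm).
    rewrite !pow_1. intros hX hY h1 h2 hK.
    set (s := sinh u ^ 2) in *. set (K := kernel_cst (A / 2)) in *.
    assert (hs : 0 <= s) by apply pow2_ge_0.
    replace (_ - _ - _) with (cos (w * u) * ((y - A) ^ 2 * (/ (A + s) * / (A + s) * / (y + s))))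
      by (field; lra).
    rewrite Rabs_mult, (Rabs_pos_eq (_ * _)).
    2:{ apply Rmult_le_pos; [apply pow2_ge_0 |]. repeat apply Rmult_le_pos; lra. }
    replace (K ^ 3 * (y - A) ^ 2 / cosh u) with (1 * ((y - A) ^ 2 * (K ^ 3 * / cosh u))) by (unfold Rdiv; ring).
    apply Rmult_le_compat; try apply Rabs_pos; try apply Rabs_cos_le_1.
    { apply Rmult_le_pos; [apply pow2_ge_0 |]. repeat apply Rmult_le_pos; lra. }
    apply Rmult_le_compat_l; [apply pow2_ge_0 |].
    set (q := / cosh u ^ 2) in *.
    apply Rle_trans with ((K * q) * (K * q) * (K * q)).
    + apply Rmult_le_compat; try lra; [apply Rmult_le_pos; lra |]. apply Rmult_le_compat; lra.
    + replace (K * q * (K * q) * (K * q)) with (K ^ 3 * (q * (q * q))) by ring.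
      apply Rmult_le_compat_l; [left; apply pow_lt, hK |]. nra.
Qed.

Lemma is_derive_G2 (w A : R) : 0 < A -> is_derive (G 2 w) A (- 2 * G 3 w A).
Proof.
  intro hA.
  apply is_derive_line_integral with (F := kernel 2 w) (F1 := fun u => - 2 * kernel 3 w A u)
    (delta := A / 2) (M := 3 * kernel_cst (A / 2) ^ 4); [lra | | |].
  - intros y hy. apply Rabs_le_between in hy. apply line_int_kernel. lra.
  - apply (is_RInt_gen_scal (V := R_NormedModule) (kernel 3 w A)), line_int_kernel, hA.
  - intros y u hy. apply Rabs_le_between in hy. unfold kernel.
    assert (hm : 0 < A / 2) by lra.
    generalize (inv_shift_pow_bound 0 (A / 2) A u hm ltac:(lra)),
      (inv_shift_pow_bound 0 (A / 2) y u hm ltac:(lra)),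
      (sech_sqr_le u), (sech_sqr_le_1 u), (cst_pos _ hm).
    rewrite !pow_1. intros hX hY h1 h2 hK.
    set (s := sinh u ^ 2) in *. set (K := kernel_cst (A / 2)) in *.
    assert (hs : 0 <= s) by apply pow2_ge_0.
    set (X := / (A + s)) in *. set (Y := / (y + s)) in *.
    replace (_ - _ - _) with (cos (w * u) * ((y - A) ^ 2 * (X * X * Y * Y + 2 * (X * X * X * Y))))
      by (unfold X, Y; field; lra).
    rewrite Rabs_mult, (Rabs_pos_eq (_ * _)).
    2:{ apply Rmult_le_pos; [apply pow2_ge_0 |].
        assert (0 <= X * X * Y * Y) by (repeat apply Rmult_le_pos; lra).
        assert (0 <= X * X * X * Y) by (repeat apply Rmult_le_pos; lra). lra. }
    replace (3 * K ^ 4 * (y - A) ^ 2 / cosh u)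
      with (1 * ((y - A) ^ 2 * (3 * K ^ 4 * / cosh u))) by (unfold Rdiv; ring).
    set (q := / cosh u ^ 2) in *.
    assert (mon : forall a b c d, 0 <= a <= K * q -> 0 <= b <= K * q -> 0 <= c <= K * q -> 0 <= d <= K * q ->
      0 <= a * b * c * d <= K ^ 4 * / cosh u).
    { intros a b c d ha hb hc hd. split; [repeat apply Rmult_le_pos; lra |].
      apply Rle_trans with ((K * q) * (K * q) * (K * q) * (K * q)).
      - repeat apply Rmult_le_compat; try lra; repeat apply Rmult_le_pos; lra.
      - replace (K * q * (K * q) * (K * q) * (K * q)) with (K ^ 4 * (q * (q * (q * q)))) by ring.
        apply Rmult_le_compat_l; [left; apply pow_lt, hK |].
        apply Rle_trans with (2 := h1).
        rewrite <- (Rmult_1_r q) at 5. apply Rmult_le_compat_l; nra. }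
    generalize (mon X X Y Y ltac:(lra) ltac:(lra) ltac:(lra) ltac:(lra)),
      (mon X X X Y ltac:(lra) ltac:(lra) ltac:(lra) ltac:(lra)). intros m1 m2.
    apply Rmult_le_compat; try apply Rabs_pos; try apply Rabs_cos_le_1.
    { apply Rmult_le_pos; [apply pow2_ge_0 | lra]. }
    apply Rmult_le_compat_l; [apply pow2_ge_0 | lra].
Qed.

(** With [X = A + sinh^2 u], the second derivative in [u] of [f = 1 / X] is
    [4 / X + 6 (1 - 2 A) / X^2 - 8 A (1 - A) / X^3].  The function
    [f' cos (w u) + w f sin (w u)] vanishes at both ends, and its derivative is
    [(f'' + w^2 f) cos (w u)], whose integral is therefore zero. *)
Lemma G_recurrence (w A : R) : 0 < A ->
  (4 + w ^ 2) * G 1 w A + 6 * (1 - 2 * A) * G 2 w A - 8 * A * (1 - A) * G 3 w A = 0.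
Proof.
  intro hA.
  set (B := fun u => - (2 * sinh u * cosh u) / (A + sinh u ^ 2) ^ 2 * cos (w * u)
                     + w * / (A + sinh u ^ 2) * sin (w * u)).
  set (f := fun u => (4 + w ^ 2) * kernel 1 w A u + 6 * (1 - 2 * A) * kernel 2 w A u
                     - 8 * A * (1 - A) * kernel 3 w A u).
  assert (hpos : forall u, A + sinh u ^ 2 <> 0) by (intro u; generalize (pow2_ge_0 (sinh u)); lra).
  assert (dB : forall u, is_derive B u (f u)).
  { intro u. unfold B. generalize (hpos u). intro hu.
    auto_derive.
    - simpl in hu |- *. repeat split; auto with real.
    - unfold f, kernel. simpl pow. simpl pow in hu.
      generalize (cosh_sinh_sqr u). simpl pow. intro hc.
      set (X := A + sinh u * (sinh u * 1)) in *.
      assert (hs : sinh u * sinh u = X - A) by (unfold X; ring).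
      assert (hcc : cosh u * cosh u = 1 + X - A) by lra.
      (* the pointwise identity behind the recurrence: once the squares of sinh and
         cosh are written in X, it is rational in X *)
      assert (key : forall c,
        -(2 * (cosh u * cosh u) + 2 * (sinh u * sinh u)) / (X * X) * c
        + 8 * (sinh u * sinh u) * (cosh u * cosh u) / (X * X * X) * c + w * w * c / X
        = (4 + w * w) * (c / X) + 6 * (1 - 2 * A) * (c / (X * X)) - 8 * A * (1 - A) * (c / (X * X * X))).
      { intros c. rewrite hs, hcc. field. auto. }
      match goal with |- _ = ?r => replace r with
       ((4 + w * w) * (cos (w * u) / X) + 6 * (1 - 2 * A) * (cos (w * u) / (X * X)) - 8 * A * (1 - A) * (cos (w * u) / (X * X * X))) by (field; auto) end.
      rewrite <- key. field. auto. }
  assert (bB : forall u, Rabs (B u) <= (2 * kernel_cst A ^ 2 + Rabs w * kernel_cst A) / cosh u).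
  { intro u. unfold B.
    generalize (cosh_ge_1 u), (cosh_sinh_sqr u), (pow2_ge_0 (sinh u)),
      (inv_shift_bound A A u hA (Rle_refl A)), (sech_sqr_le u), (cst_pos A hA).
    intros h1 h2 h3 hX hq hK.
    assert (hcc : 0 < / cosh u) by (apply Rinv_0_lt_compat; lra).
    apply Rle_trans with (1 := Rabs_triang _ _).
    unfold Rdiv. rewrite Rmult_plus_distr_r. rewrite !Rabs_mult.
    rewrite Rabs_Ropp, !Rabs_mult, (Rabs_pos_eq 2), (Rabs_pos_eq (cosh u)) by lra.
    assert (hsc : Rabs (sinh u) <= cosh u).
    { apply Rabs_le; split; nra. }
    rewrite <- (pow_inv (A + sinh u ^ 2)).
    set (X := / (A + sinh u ^ 2)) in *.
    rewrite (Rabs_pos_eq (X ^ 2)) by (apply pow2_ge_0). rewrite (Rabs_pos_eq X) by lra.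
    set (c := cosh u) in *. set (s := sinh u) in *. clearbody c s.
    assert (hq2 : c ^ 2 * / c ^ 2 = 1) by (field; lra).
    apply Rplus_le_compat.
    - rewrite <- (Rmult_1_r (_ * / c)).
      apply Rmult_le_compat; try apply Rabs_pos; try apply Rabs_cos_le_1.
      { repeat apply Rmult_le_pos; try lra; apply Rabs_pos. }
      apply Rle_trans with (2 * c * c * (kernel_cst A * / c ^ 2) ^ 2).
      + apply Rmult_le_compat; [repeat apply Rmult_le_pos; try lra; apply Rabs_pos | apply pow2_ge_0 | |].
        * repeat apply Rmult_le_compat; try lra; try apply Rabs_pos. apply Rmult_le_pos; [lra | apply Rabs_pos].
        * apply pow_incr. lra.
      + replace (2 * c * c * (kernel_cst A * / c ^ 2) ^ 2)
          with (2 * kernel_cst A ^ 2 * ((c ^ 2 * / c ^ 2) * / c ^ 2)) by (field; lra).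
        rewrite hq2, Rmult_1_l. apply Rmult_le_compat_l; nra.
    - rewrite <- (Rmult_1_r (_ * / c)).
      apply Rmult_le_compat; try apply Rabs_pos.
      { apply Rmult_le_pos; [apply Rabs_pos | lra]. }
      + rewrite Rmult_assoc. apply Rmult_le_compat_l; [apply Rabs_pos |]. nra.
      + apply Rabs_le, SIN_bound. }
  assert (h0 : line_int f (0 - 0)).
  { apply line_int_derive with B; auto.
    - intro u. unfold f.
      apply (continuous_minus (V := R_NormedModule)); [apply (continuous_plus (V := R_NormedModule)) |];
      apply (continuous_scal_r (V := R_NormedModule)), continuous_kernel, hA.
    - apply sech_decay_lim with (2 := bB). auto.
    - apply sech_decay_lim with (2 := bB). auto. }
  assert (h1 : line_int f ((4 + w ^ 2) * G 1 w A + 6 * (1 - 2 * A) * G 2 w A - 8 * A * (1 - A) * G 3 w A)).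
  { apply (is_RInt_gen_minus (V := R_NormedModule)
      (fun u => (4 + w ^ 2) * kernel 1 w A u + 6 * (1 - 2 * A) * kernel 2 w A u)
      (fun u => 8 * A * (1 - A) * kernel 3 w A u)).
    apply (is_RInt_gen_plus (V := R_NormedModule)
      (fun u => (4 + w ^ 2) * kernel 1 w A u) (fun u => 6 * (1 - 2 * A) * kernel 2 w A u)).
    all: apply (is_RInt_gen_scal (V := R_NormedModule) (kernel _ w A)), line_int_kernel, hA. }
  apply line_int_unique in h0. apply line_int_unique in h1. lra.
Qed.

(** * The differential equation in the angle *)

(** Both Wronskian-type expressions [H w2 - P w1] and [P w2 - mu H w1] are
    constant, and so is [w2^2 - mu w1^2], which equals [1]; solving the
    resulting linear system for [H T] gives the value. *)
Lemma linear_ode_unique (mu T : R) (H P w1 w2 : R -> R) :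
  0 < T ->
  (forall t, 0 <= t <= T -> is_derive H t (P t)) ->
  (forall t, 0 <= t <= T -> is_derive P t (mu * H t)) ->
  (forall t, is_derive w1 t (w2 t)) ->
  (forall t, is_derive w2 t (mu * w1 t)) ->
  H 0 = 0 -> w1 0 = 0 -> w2 0 = 1 ->
  H T = P 0 * w1 T.
Proof.
  intros hT dH dP d1 d2 H0 w10 w20.
  assert (constant : forall f f' : R -> R, (forall t, 0 <= t <= T -> is_derive f t (f' t)) ->
    (forall t, f' t = 0) -> f T = f 0).
  { intros f f' df hf'. symmetry. apply (eq_is_derive (V := R_NormedModule)) with (2 := hT).
    intros t ht. change (is_derive f t 0). rewrite <- (hf' t). auto. }
  assert (prod : forall f f' g g' t, is_derive f t f' -> is_derive g t g' ->
    is_derive (fun t => f t * g t) t (f' * g t + f t * g')).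
  { intros. apply (is_derive_mult (K := R_AbsRing)); auto. intros; apply Rmult_comm. }
  assert (e1 : H T * w2 T - P T * w1 T = H 0 * w2 0 - P 0 * w1 0).
  { apply (constant (fun t => H t * w2 t - P t * w1 t)
      (fun t => (P t * w2 t + H t * (mu * w1 t)) - (mu * H t * w1 t + P t * w2 t))); [| intro; ring].
    intros t ht. apply (is_derive_minus (V := R_NormedModule) (fun t => H t * w2 t) (fun t => P t * w1 t));
      apply prod; auto. }
  assert (e2 : P T * w2 T - mu * (H T * w1 T) = P 0 * w2 0 - mu * (H 0 * w1 0)).
  { apply (constant (fun t => P t * w2 t - mu * (H t * w1 t))
      (fun t => (mu * H t * w2 t + P t * (mu * w1 t)) - mu * (P t * w1 t + H t * w2 t))); [| intro; ring].
    intros t ht. apply (is_derive_minus (V := R_NormedModule) (fun t => P t * w2 t) (fun t => mu * (H t * w1 t))).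
    - apply prod; auto.
    - apply is_derive_scal. apply prod; auto. }
  assert (e3 : w2 T * w2 T - mu * (w1 T * w1 T) = w2 0 * w2 0 - mu * (w1 0 * w1 0)).
  { apply (constant (fun t => w2 t * w2 t - mu * (w1 t * w1 t))
      (fun t => (mu * w1 t * w2 t + w2 t * (mu * w1 t)) - mu * (w2 t * w1 t + w1 t * w2 t))); [| intro; ring].
    intros t ht. apply (is_derive_minus (V := R_NormedModule) (fun t => w2 t * w2 t) (fun t => mu * (w1 t * w1 t))).
    - apply prod; auto.
    - apply is_derive_scal. apply prod; auto. }
  rewrite H0, w10, w20 in *.
  replace (H T) with (H T * (w2 T * w2 T - mu * (w1 T * w1 T))) by (rewrite e3; ring).
  replace (H T * (w2 T * w2 T - mu * (w1 T * w1 T))) with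
    ((H T * w2 T - P T * w1 T) * w2 T + (P T * w2 T - mu * (H T * w1 T)) * w1 T) by ring.
  rewrite e1, e2. ring.
Qed.

(** The two substitutions [A = cos^2 t] and [A = cosh^2 t] share all their algebra:
    [S] and [C] are sine and cosine for [eps = 1], hyperbolic ones for
    [eps = -1].  The factor [S * C] turns the equation of [G_recurrence] into
    [H'' = eps * w^2 * H]. *)
Lemma G1_closed_form (eps w T : R) (S C w1 w2 : R -> R) :
  0 < T ->
  (forall t, is_derive S t (C t)) -> (forall t, is_derive C t (- eps * S t)) ->
  (forall t, C t ^ 2 + eps * S t ^ 2 = 1) ->
  (forall t, 0 <= t <= T -> C t <> 0) ->
  (forall t, is_derive w1 t (w2 t)) -> (forall t, is_derive w2 t (eps * w ^ 2 * w1 t)) ->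
  S 0 = 0 -> w1 0 = 0 -> w2 0 = 1 ->
  S T * C T * G 1 w (C T ^ 2) = G 1 w 1 * w1 T.
Proof.
  intros hT dS dC hSC hC d1 d2 S0 w10 w20.
  set (H := fun t => S t * C t * G 1 w (C t ^ 2)).
  set (P := fun t => (C t ^ 2 - eps * S t ^ 2) * G 1 w (C t ^ 2)
                     + 2 * eps * S t ^ 2 * C t ^ 2 * G 2 w (C t ^ 2)).
  assert (hpos : forall t, 0 <= t <= T -> 0 < C t ^ 2) by (intros t ht; apply pow2_gt_0; auto).
  assert (hC0 : C 0 ^ 2 = 1) by (generalize (hSC 0); rewrite S0; intro; nra).
  assert (hP0 : P 0 = G 1 w 1).
  { unfold P. rewrite hC0, S0. ring. }
  rewrite <- hP0. change (H T = P 0 * w1 T).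
  apply linear_ode_unique with (mu := eps * w ^ 2) (w2 := w2); auto.
  - intros t ht. unfold H, P.
    generalize (is_derive_G1 w (C t ^ 2) (hpos t ht)). intro dG1.
    auto_derive.
    + repeat split; eexists; eauto.
    + rewrite (is_derive_unique (fun x : R => S x) _ _ (dS t)), (is_derive_unique (fun x : R => C x) _ _ (dC t)).
      replace (Derive (fun x : R => G 1 w x) _) with (- G 2 w (C t ^ 2)) by (symmetry; apply is_derive_unique, dG1).
      simpl. ring.
  - intros t ht. unfold H, P.
    generalize (is_derive_G1 w (C t ^ 2) (hpos t ht)). intro dG1.
    generalize (is_derive_G2 w (C t ^ 2) (hpos t ht)). intro dG2.
    auto_derive.
    + repeat split; eexists; eauto.
    + rewrite (is_derive_unique (fun x : R => S x) _ _ (dS t)), (is_derive_unique (fun x : R => C x) _ _ (dC t)).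
      replace (Derive (fun x : R => G 1 w x) _) with (- G 2 w (C t ^ 2)) by (symmetry; apply is_derive_unique, dG1).
      replace (Derive (fun x : R => G 2 w x) _) with (- 2 * G 3 w (C t ^ 2)) by (symmetry; apply is_derive_unique, dG2).
      (* eliminate G 3 between the computed derivative and the recurrence *)
      generalize (G_recurrence w (C t ^ 2) (hpos t ht)). intro rec.
      replace (1 - C t ^ 2) with (eps * S t ^ 2) in rec by (rewrite <- (hSC t); ring).
      replace (1 - 2 * C t ^ 2) with (eps * S t ^ 2 - C t ^ 2) in rec by (rewrite <- (hSC t); ring).
      replace (C t * (C t * 1)) with (C t ^ 2) by reflexivity.
      set (g1 := G 1 w (C t ^ 2)) in *. set (g2 := G 2 w (C t ^ 2)) in *.
      set (g3 := G 3 w (C t ^ 2)) in *.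
      match goal with |- ?l = ?r => replace l with (r - eps * S t * C t *
        ((4 + w ^ 2) * g1 + 6 * (eps * S t ^ 2 - C t ^ 2) * g2 - 8 * C t ^ 2 * (eps * S t ^ 2) * g3)) by ring end.
      rewrite rec. ring.
  - unfold H. rewrite S0. ring.
Qed.

Lemma G1_hyperbolic (w eta : R) : w <> 0 -> 0 < eta ->
  sinh eta * cosh eta * G 1 w (cosh eta ^ 2) = G 1 w 1 * (sin (w * eta) / w).
Proof.
  intros hw heta.
  apply (G1_closed_form (-1) w eta sinh cosh (fun t => sin (w * t) / w) (fun t => cos (w * t))); auto.
  - intro t. apply is_derive_Reals, derivable_pt_lim_sinh.
  - intro t. replace (- -1 * sinh t) with (sinh t) by ring. apply is_derive_Reals, derivable_pt_lim_cosh.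
  - intro t. generalize (cosh_sinh_sqr t). lra.
  - intros t _. generalize (cosh_ge_1 t). lra.
  - intro t. auto_derive; auto. field; auto.
  - intro t. auto_derive; auto. field; auto.
  - apply sinh_0.
  - rewrite Rmult_0_r, sin_0. field; auto.
  - rewrite Rmult_0_r. apply cos_0.
Qed.

Lemma G1_trigonometric (w th : R) : w <> 0 -> 0 < th < PI / 2 ->
  sin th * cos th * G 1 w (cos th ^ 2) = G 1 w 1 * (sinh (w * th) / w).
Proof.
  intros hw hth.
  apply (G1_closed_form 1 w th sin cos (fun t => sinh (w * t) / w) (fun t => cosh (w * t))); auto.
  - lra.
  - intro t. apply is_derive_Reals, derivable_pt_lim_sin.
  - intro t. replace (Ropp 1 * sin t) with (- sin t) by ring. apply is_derive_Reals, derivable_pt_lim_cos.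
  - intro t. generalize (sin2_cos2 t). unfold Rsqr. lra.
  - intros t ht. apply Rgt_not_eq, cos_gt_0; lra.
  - intro t. auto_derive; auto. field; auto.
  - intro t. auto_derive; auto. field; auto.
  - apply sin_0.
  - rewrite Rmult_0_r, sinh_0. field; auto.
  - rewrite Rmult_0_r. apply cosh_0.
Qed.

(** * The limit at the right angle *)

Lemma tanh_lim_p : filterlim (fun u => sinh u / cosh u) (Rbar_locally p_infty) (locally 1).
Proof.
  apply filterlim_ext with (fun u => 1 + - (exp (- u) / cosh u)).
  { intro u. generalize (cosh_ge_1 u). intro h. unfold Rdiv.
    replace (sinh u) with (cosh u - exp (- u)) by (unfold cosh, sinh; lra). field. lra. }
  replace (locally 1) with (locally (1 + 0)) by (f_equal; ring).
  apply (filterlim_comp_2 (G := locally 1) (H := locally 0)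
    (fun _ => 1) (fun u => - (exp (- u) / cosh u)) Rplus).
  - apply filterlim_const.
  - apply filterlim_ext_loc with (fun u => - (exp (- Rmax u 0) / cosh u)).
    { exists 0. intros u hu. rewrite Rmax_left; lra. }
    apply sech_decay_lim with 1; auto. intro u.
    generalize (cosh_ge_1 u). intro h.
    rewrite Rabs_Ropp. unfold Rdiv. rewrite Rabs_mult, Rabs_inv, (Rabs_pos_eq (cosh u)) by lra.
    apply Rmult_le_compat_r; [left; apply Rinv_0_lt_compat; lra |].
    rewrite Rabs_pos_eq by (left; apply exp_pos).
    rewrite <- exp_0. generalize (Rmax_r u 0). intros [h1 | h1].
    + left. apply exp_increasing. lra.
    + rewrite <- h1. right. f_equal. lra.
  - apply (filterlim_plus (V := R_NormedModule)).
Qed.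

(** A primitive of [sin th cos th / (cos^2 th + sinh^2 u)] is
    [atan (tan th * tanh u)]. *)
Lemma G1_zero (th : R) : 0 < th < PI / 2 -> sin th * cos th * G 1 0 (cos th ^ 2) = 2 * th.
Proof.
  intros hth.
  assert (hs : 0 < sin th) by (apply sin_gt_0; lra).
  assert (hc : 0 < cos th) by (apply cos_gt_0; lra).
  assert (hA : 0 < cos th ^ 2) by (apply pow_lt; lra).
  assert (lim : filterlim (fun u => atan (tan th * (sinh u / cosh u))) (Rbar_locally p_infty) (locally th)).
  { replace (locally th) with (locally (atan (tan th))) by (rewrite atan_tan; auto; lra).
    apply (filterlim_comp _ _ _ (fun u => tan th * (sinh u / cosh u)) atan _ (locally (tan th))).
    - replace (locally (tan th)) with (locally (tan th * 1)) by (f_equal; ring).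
      apply (filterlim_comp _ _ _ (fun u => sinh u / cosh u) (fun x => tan th * x) _ (locally 1)).
      + apply tanh_lim_p.
      + apply (filterlim_scal_r (V := R_NormedModule) (tan th)).
    - apply (ex_derive_continuous (V := R_NormedModule) atan). auto_derive. auto. }
  assert (h1 : line_int (fun u => sin th * cos th * kernel 1 0 (cos th ^ 2) u) (th - - th)).
  { apply line_int_derive with (fun u => atan (tan th * (sinh u / cosh u))); auto.
    - intro u. generalize (cosh_ge_1 u), (cosh_sinh_sqr u). intros h1 h2.
      auto_derive; [lra |].
      unfold kernel, tan. rewrite Rmult_0_l, cos_0.
      generalize (sin2_cos2 th). unfold Rsqr. intro h3.
      assert (h4 : 0 <= sinh u ^ 2) by apply pow2_ge_0.
      assert (h5 : cos th ^ 2 * cosh u ^ 2 + sin th ^ 2 * sinh u ^ 2 = cos th ^ 2 + sinh u ^ 2).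
      { rewrite h2. replace (sin th ^ 2) with (1 - cos th ^ 2) by lra. ring. }
      assert (h6 : cosh u * cosh u - sinh u * sinh u = 1) by (simpl in h2; lra).
      rewrite pow_1, <- h5.
      transitivity (sin th * cos th * (cosh u * cosh u - sinh u * sinh u) / (cos th ^ 2 * cosh u ^ 2 + sin th ^ 2 * sinh u ^ 2)).
      2:{ rewrite h6. field. nra. }
      field. repeat split; try lra; simpl in *; nra.
    - intro u. apply (continuous_scal_r (V := R_NormedModule)), continuous_kernel, hA.
    - apply odd_lim_m with (2 := lim). intro u. rewrite sinh_odd, cosh_even, <- atan_opp. f_equal.
      unfold Rdiv. ring. }
  assert (h2 : line_int (fun u => sin th * cos th * kernel 1 0 (cos th ^ 2) u) (sin th * cos th * G 1 0 (cos th ^ 2))).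
  { apply (is_RInt_gen_scal (V := R_NormedModule) (kernel 1 0 (cos th ^ 2))), line_int_kernel, hA. }
  apply line_int_unique in h1. apply line_int_unique in h2. lra.
Qed.

Lemma Rabs_sin_le (x : R) : Rabs (sin x) <= Rabs x.
Proof.
  assert (pos : forall y, 0 <= y -> Rabs (sin y) <= y).
  { intros y hy. destruct (Rle_dec y 1) as [h1 | h1].
    - generalize PI2_1. intro hp. rewrite Rabs_pos_eq by (apply sin_ge_0; lra).
      destruct hy as [hy | <-]; [left; apply sin_lt_x, hy | rewrite sin_0; lra].
    - apply Rle_trans with 1; [apply Rabs_le, SIN_bound | lra]. }
  destruct (Rle_dec 0 x) as [h | h].
  - rewrite (Rabs_pos_eq x); auto.
  - rewrite <- (Rabs_Ropp (sin x)), <- sin_neg, <- (Rabs_Ropp x), (Rabs_pos_eq (- x)) by lra.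
    apply pos. lra.
Qed.

(** Near [u = 0] the quadratic bound [1 - cos (w u) <= 2 w^2 sinh^2 u] is used, far
    from it the bound by [2]; the product with [1 + sinh^2 u] combines both. *)
Lemma one_minus_cos_bound (w u : R) :
  0 <= 1 - cos (w * u) /\ (1 - cos (w * u)) * (1 + sinh u ^ 2) <= (2 * w ^ 2 + 2) * sinh u ^ 2.
Proof.
  generalize (COS_bound (w * u)). intro hb. split; [lra |].
  assert (h1 : 1 - cos (w * u) <= 2 * w ^ 2 * sinh u ^ 2).
  { replace (w * u) with (2 * (w * u / 2)) by field. rewrite cos_2a_sin.
    generalize (Rabs_sin_le (w * u / 2)), (Rabs_le_sinh u). intros h1 h2.
    apply Rsqr_le_abs_1 in h1. unfold Rsqr in h1.
    assert (h3 : u ^ 2 <= 4 * sinh u ^ 2).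
    { rewrite <- (pow2_abs u), <- (pow2_abs (sinh u)). generalize (Rabs_pos u). nra. }
    assert (h4 : w ^ 2 * u ^ 2 <= w ^ 2 * (4 * sinh u ^ 2)) by (apply Rmult_le_compat_l; [apply pow2_ge_0 | auto]).
    nra. }
  generalize (pow2_ge_0 (sinh u)). nra.
Qed.

(** The bound is uniform in [A], although both integrals blow up as [A -> 0]:
    [1 - cos (w u)] vanishes to second order at the singularity. *)
Lemma G1_frequency_bound (w A : R) : 0 < A ->
  Rabs (G 1 w A - G 1 0 A) <= (2 * w ^ 2 + 2) * PI.
Proof.
  intro hA.
  apply line_int_sech_bound with (fun u => kernel 1 w A u - kernel 1 0 A u).
  - intro u. unfold kernel. rewrite Rmult_0_l, cos_0, !pow_1.
    generalize (one_minus_cos_bound w u). intros [h0 h1].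
    generalize (cosh_ge_1 u), (cosh_sinh_sqr u), (sech_sqr_le u), (pow2_ge_0 (sinh u)), (pow2_ge_0 w).
    intros h2 h3 h4 h5 h6.
    replace (cos (w * u) / (A + sinh u ^ 2) - 1 / (A + sinh u ^ 2))
      with (- ((1 - cos (w * u)) / (A + sinh u ^ 2))) by (field; lra).
    rewrite Rabs_Ropp, Rabs_pos_eq.
    2:{ apply Rmult_le_pos; [lra | left; apply Rinv_0_lt_compat; lra]. }
    apply Rle_trans with ((2 * w ^ 2 + 2) * / cosh u ^ 2).
    2:{ apply Rmult_le_compat_l; lra. }
    rewrite h3.
    apply (Rmult_le_reg_r ((A + sinh u ^ 2) * (1 + sinh u ^ 2))); [nra |].
    replace ((1 - cos (w * u)) / (A + sinh u ^ 2) * ((A + sinh u ^ 2) * (1 + sinh u ^ 2)))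
      with ((1 - cos (w * u)) * (1 + sinh u ^ 2)) by (field; lra).
    replace ((2 * w ^ 2 + 2) * / (1 + sinh u ^ 2) * ((A + sinh u ^ 2) * (1 + sinh u ^ 2)))
      with ((2 * w ^ 2 + 2) * (A + sinh u ^ 2)) by (field; lra).
    nra.
  - apply (is_RInt_gen_minus (V := R_NormedModule) (kernel 1 w A) (kernel 1 0 A)); apply line_int_kernel, hA.
Qed.

Lemma sinh_neq_0 (x : R) : x <> 0 -> sinh x <> 0.
Proof.
  intros hx h. apply hx. generalize (Rabs_le_sinh x). rewrite h, Rabs_R0. intro h1.
  destruct (Req_dec x 0) as [-> | hx']; auto. generalize (Rabs_pos_lt x hx'). lra.
Qed.

(** For [0 < th < pi/2] the closed forms for the frequencies [w] and [0] differ by at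
    most [K sin th cos th], which tends to [0] as [th -> pi/2]; there the closed
    forms are [G 1 w 1 * sinh (w pi/2) / w] and [pi]. *)
Lemma G1_at_one (w : R) : w <> 0 -> G 1 w 1 = PI * w / sinh (w * (PI / 2)).
Proof.
  intro hw. assert (hpi := PI_RGT_0).
  set (K := (2 * w ^ 2 + 2) * PI).
  (* psi is continuous and nonnegative on (0, pi/2), hence nonnegative at pi/2,
     where only minus the absolute value remains *)
  set (psi := fun th => K * (sin th * cos th) - Rabs (G 1 w 1 * (sinh (w * th) / w) - 2 * th)).
  assert (h0 : forall th, 0 < th < PI / 2 -> 0 <= psi th).
  { intros th hth.
    assert (hs : 0 < sin th) by (apply sin_gt_0; lra).
    assert (hc : 0 < cos th) by (apply cos_gt_0; lra).
    unfold psi. rewrite <- G1_trigonometric, <- (G1_zero th) by auto.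
    rewrite <- Rmult_minus_distr_l, Rabs_mult, (Rabs_pos_eq (sin th * cos th)) by nra.
    generalize (G1_frequency_bound w (cos th ^ 2) ltac:(apply pow_lt; lra)). fold K. intro hb.
    set (d := Rabs (G 1 w (cos th ^ 2) - G 1 0 (cos th ^ 2))) in *.
    replace (_ - _) with (sin th * cos th * (K - d)) by ring.
    apply Rmult_le_pos; [nra | lra]. }
  assert (hcont : continuous psi (PI / 2)).
  { apply (continuous_minus (V := R_NormedModule)).
    - apply (ex_derive_continuous (V := R_NormedModule)). auto_derive. auto.
    - apply (continuous_comp (fun th => G 1 w 1 * (sinh (w * th) / w) - 2 * th) Rabs).
      + apply (ex_derive_continuous (V := R_NormedModule)). auto_derive. auto.
      + apply continuous_Rabs. }
  assert (hlim : Rbar_le 0 (psi (PI / 2))).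
  { apply (filterlim_le (F := at_left (PI / 2)) (fun _ => 0) psi).
    - assert (hd : 0 < PI / 2) by lra. exists (mkposreal _ hd). intros y hy hy'.
      apply h0. change (Rabs (y - PI / 2) < PI / 2) in hy. apply Rabs_def2 in hy. lra.
    - apply filterlim_const.
    - apply filterlim_filter_le_1 with (2 := hcont). intros P HP. unfold at_left, within.
      apply filter_imp with (2 := HP). auto. }
  simpl in hlim. unfold psi in hlim. rewrite cos_PI2, !Rmult_0_r in hlim.
  assert (he : G 1 w 1 * (sinh (w * (PI / 2)) / w) - 2 * (PI / 2) = 0).
  { apply Rabs_eq_0. generalize (Rabs_pos (G 1 w 1 * (sinh (w * (PI / 2)) / w) - 2 * (PI / 2))). lra. }
  assert (hn : sinh (w * (PI / 2)) <> 0).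
  { apply sinh_neq_0. apply Rmult_integral_contrapositive. split; [auto | apply Rgt_not_eq; lra]. }
  replace (PI * w) with (G 1 w 1 * (sinh (w * (PI / 2)) / w) * w) by (replace (G 1 w 1 * (sinh (w * (PI / 2)) / w)) with PI by lra; reflexivity).
  field. auto.
Qed.

(** * Joint continuity in frequency and parameter *)

Lemma Rabs_cos_diff_le (x y : R) : Rabs (cos x - cos y) <= Rabs (x - y).
Proof.
  rewrite form2, !Rabs_mult, (Rabs_left (-2)) by lra.
  generalize (Rabs_sin_le ((x - y) / 2)). intro h1.
  assert (h2 : Rabs (sin ((x + y) / 2)) <= 1) by apply Rabs_le, SIN_bound.
  unfold Rdiv in h1 at 2. rewrite Rabs_mult, (Rabs_pos_eq (/ 2)) in h1 by lra.
  generalize (Rabs_pos (sin ((x - y) / 2))), (Rabs_pos (sin ((x + y) / 2))). nra.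
Qed.

(** In the frequency direction the difference of the cosines costs a factor
    [|u| <= 2 cosh u], which the decay [1 / cosh^2 u] of the kernel absorbs. *)
Lemma G1_lipschitz (m w w' A A' : R) : 0 < m -> m <= A -> m <= A' ->
  Rabs (G 1 w' A' - G 1 w A) <= (2 * kernel_cst m * Rabs (w' - w) + kernel_cst m ^ 2 * Rabs (A' - A)) * PI.
Proof.
  intros hm hA hA'.
  apply line_int_sech_bound with (fun u => kernel 1 w' A' u - kernel 1 w A u).
  2:{ apply (is_RInt_gen_minus (V := R_NormedModule) (kernel 1 w' A') (kernel 1 w A));
        apply line_int_kernel; lra. }
  intro u. unfold kernel. rewrite !pow_1.
  generalize (inv_shift_bound m A u hm hA), (inv_shift_bound m A' u hm hA'), (cst_pos m hm),
    (cosh_ge_1 u), (sech_sqr_le u), (sech_sqr_le_1 u), (Rabs_le_cosh u), (pow2_ge_0 (sinh u)).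
  intros hX hX' hK hc h1 h2 h3 h4.
  set (K := kernel_cst m) in *.
  replace (cos (w' * u) / (A' + sinh u ^ 2) - cos (w * u) / (A + sinh u ^ 2)) with
    ((cos (w' * u) - cos (w * u)) * / (A' + sinh u ^ 2)
     + cos (w * u) * ((A - A') * (/ (A + sinh u ^ 2) * / (A' + sinh u ^ 2)))) by (field; lra).
  set (X := / (A + sinh u ^ 2)) in *. set (X' := / (A' + sinh u ^ 2)) in *.
  apply Rle_trans with (1 := Rabs_triang _ _).
  unfold Rdiv. rewrite Rmult_plus_distr_r. apply Rplus_le_compat.
  - rewrite Rabs_mult, (Rabs_pos_eq X') by lra.
    apply Rle_trans with ((Rabs (w' - w) * (2 * cosh u)) * (K * / cosh u ^ 2)).
    + apply Rmult_le_compat; [apply Rabs_pos | lra | | lra].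
      apply Rle_trans with (1 := Rabs_cos_diff_le _ _).
      rewrite <- Rmult_minus_distr_r, Rabs_mult.
      apply Rmult_le_compat_l; [apply Rabs_pos | exact h3].
    + right. field. lra.
  - rewrite Rabs_mult, <- (Rmult_1_l (K ^ 2 * _ * _)).
    apply Rmult_le_compat; try apply Rabs_pos; [apply Rabs_cos_le_1 |].
    rewrite Rabs_mult, (Rabs_pos_eq (X * X')), Rabs_minus_sym by (apply Rmult_le_pos; lra).
    replace (K ^ 2 * Rabs (A' - A) * / cosh u) with (Rabs (A' - A) * (K ^ 2 * / cosh u)) by ring.
    apply Rmult_le_compat_l; [apply Rabs_pos |].
    set (q := / cosh u ^ 2) in *.
    apply Rle_trans with ((K * q) * (K * q)); [apply Rmult_le_compat; lra |].
    replace (K * q * (K * q)) with (K ^ 2 * (q * q)) by ring.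
    apply Rmult_le_compat_l; [apply pow2_ge_0 | nra].
Qed.

Lemma G1_continuous (f h : R * R -> R) (p : R * R) :
  continuous f p -> continuous h p -> 0 < h p -> continuous (fun q => G 1 (f q) (h q)) p.
Proof.
  intros hf hh hp.
  set (m := h p / 2).
  (* the Lipschitz majorant, with parameters kept above half of the limit value *)
  set (E := fun q => (2 * kernel_cst m * Rabs (f q - f p) + kernel_cst m ^ 2 * Rabs (h q - h p)) * PI).
  assert (hE : continuous E p).
  { apply (continuous_scal_l (V := R_NormedModule)
      (fun q => 2 * kernel_cst m * Rabs (f q - f p) + kernel_cst m ^ 2 * Rabs (h q - h p)) PI).
    apply (continuous_plus (V := R_NormedModule));
      apply (continuous_scal_r (V := R_NormedModule)).
    - apply (continuous_comp (fun q => f q - f p) Rabs); [| apply continuous_Rabs].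
      apply (continuous_minus (V := R_NormedModule)); [exact hf | apply continuous_const].
    - apply (continuous_comp (fun q => h q - h p) Rabs); [| apply continuous_Rabs].
      apply (continuous_minus (V := R_NormedModule)); [exact hh | apply continuous_const]. }
  assert (hE0 : E p = 0) by (unfold E; rewrite !Rminus_diag, Rabs_R0; ring).
  apply filterlim_locally. intros eps.
  assert (hm : 0 < m) by (unfold m; lra).
  generalize (proj1 (filterlim_locally _ _) hE eps), (proj1 (filterlim_locally _ _) hh (mkposreal m hm)).
  intros near1 near2. generalize (filter_and _ _ near1 near2).
  apply filter_imp. intros q [hq1 hq2].
  change (Rabs (E q - E p) < eps) in hq1. change (Rabs (h q - h p) < m) in hq2.
  change (Rabs (G 1 (f q) (h q) - G 1 (f p) (h p)) < eps).
  apply Rabs_def2 in hq2. rewrite hE0, Rminus_0_r in hq1.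
  apply Rle_lt_trans with (2 := hq1), Rle_trans with (2 := Rle_abs _).
  apply G1_lipschitz; unfold m in *; lra.
Qed.

(** * The Fourier integral *)

Lemma line_int_scale (f : R -> R) (b l : R) :
  0 < b -> line_int f l -> line_int (fun t => f (b * t)) (/ b * l).
Proof.
  intros hb hl.
  assert (h1 : line_int (fun t => scal b (f (b * t + 0))) l).
  { intros P HP.
    assert (hm : filterlim (fun x => b * x + 0) (Rbar_locally m_infty) (Rbar_locally m_infty)).
    { intros Q [M hM]. exists (M / b). intros x hx. apply hM.
      replace M with (b * (M / b)) by (field; lra). nra. }
    assert (hp : filterlim (fun x => b * x + 0) (Rbar_locally p_infty) (Rbar_locally p_infty)).
    { intros Q [M hM]. exists (M / b). intros x hx. apply hM.
      replace M with (b * (M / b)) by (field; lra). nra. }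
    destruct (hl P HP) as [Q1 Q2 hQ1 hQ2 hQ].
    apply (Filter_prod _ _ _ (fun x => Q1 (b * x + 0)) (fun x => Q2 (b * x + 0)) (hm _ hQ1) (hp _ hQ2)).
    intros x y hx hy. destruct (hQ _ _ hx hy) as [v [hv hPv]].
    exists v. split; auto. simpl in *. apply (is_RInt_comp_lin f b 0 x y v hv). }
  apply (is_RInt_gen_scal (V := R_NormedModule) _ (/ b)) in h1.
  apply is_RInt_gen_ext with (2 := h1). apply filter_forall. intros ab x _.
  unfold scal; simpl; unfold mult; simpl. rewrite Rplus_0_r. field. lra.
Qed.

Lemma is_RInt_gen_C (f : R -> C) (l1 l2 : R) :
  line_int (fun t => fst (f t)) l1 -> line_int (fun t => snd (f t)) l2 ->
  is_RInt_gen (V := C_R_NormedModule) f (Rbar_locally m_infty) (Rbar_locally p_infty) (l1, l2).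
Proof.
  intros h1 h2.
  apply filterlimi_locally. intros eps.
  generalize (proj1 (filterlimi_locally _ _) h1 eps), (proj1 (filterlimi_locally _ _) h2 eps).
  intros n1 n2. generalize (filter_and _ _ n1 n2). apply filter_imp.
  intros ab [[z1 [i1 b1]] [z2 [i2 b2]]].
  exists (z1, z2). split.
  - apply (is_RInt_fct_extend_pair (U := R_NormedModule) (V := R_NormedModule)); auto.
  - split; auto.
Qed.

Lemma line_int_sin_kernel (w A : R) :
  0 < A -> line_int (fun u => sin (w * u) / (A + sinh u ^ 2) ^ 1) 0.
Proof.
  intro hA.
  set (f := fun u => sin (w * u) / (A + sinh u ^ 2) ^ 1).
  assert (hc : forall u, continuous f u).
  { intro u. apply (ex_derive_continuous (V := R_NormedModule)). unfold f. auto_derive.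
    generalize (pow2_ge_0 (sinh u)). simpl. lra. }
  assert (hi : line_int f (line_integral f)).
  { apply sech_dominated_int with (kernel_cst A); auto.
    intro u. unfold f. apply Rle_trans with (1 := shift_quotient_bound 0 A A u _ hA (Rle_refl A)).
    apply Rmult_le_compat_r; [left; apply Rinv_0_lt_compat; generalize (cosh_ge_1 u); lra |].
    rewrite pow_1. apply Rle_trans with (1 * kernel_cst A); [| lra].
    apply Rmult_le_compat_r; [left; apply cst_pos, hA | apply Rabs_le, SIN_bound]. }
  rewrite (line_int_odd f (line_integral f)) in hi; auto.
  intro u. unfold f. rewrite sinh_odd. replace (w * - u) with (- (w * u)) by ring.
  rewrite sin_neg. replace ((- sinh u) ^ 2) with (sinh u ^ 2) by ring. unfold Rdiv. ring.
Qed.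

Lemma Cexp_imag (t : R) : Cexp (Ci * RtoC t) = (cos t, sin t).
Proof.
  unfold Cexp, Ci, RtoC; simpl.
  replace (0 * t - 1 * 0) with 0 by ring. replace (0 * 0 + 1 * t) with t by ring.
  rewrite exp_0, !Rmult_1_l. reflexivity.
Qed.

Lemma g_fourier (a b k : R) : 0 < a -> 0 < b ->
  is_fourier (g a b) k (RtoC (/ b * G 1 (k / b) (a ^ 2))).
Proof.
  intros ha hb. assert (hA : 0 < a ^ 2) by (apply pow_lt, ha).
  assert (hint : forall t, (Cexp (Ci * RtoC k * RtoC t) * RtoC (g a b t))%C
    = (cos (k * t) * g a b t, sin (k * t) * g a b t)).
  { intro t. rewrite <- Cmult_assoc, <- RtoC_mult, Cexp_imag.
    unfold RtoC, Cmult; simpl. f_equal; ring. }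
  unfold is_fourier. apply (is_RInt_gen_C _ _ 0).
  - apply is_RInt_gen_ext with (fun t => kernel 1 (k / b) (a ^ 2) (b * t)).
    + apply filter_forall. intros ab t _. cbv beta. rewrite hint. simpl fst. unfold kernel, g.
      rewrite pow_1. unfold Rdiv. f_equal. f_equal. field. lra.
    + apply line_int_scale; auto. apply line_int_kernel, hA.
  - rewrite <- (Rmult_0_r (/ b)).
    apply is_RInt_gen_ext with (fun t => sin (k / b * (b * t)) / (a ^ 2 + sinh (b * t) ^ 2) ^ 1).
    + apply filter_forall. intros ab t _. cbv beta. rewrite hint. simpl snd. unfold g.
      rewrite pow_1. unfold Rdiv. f_equal. f_equal. field. lra.
    + apply (line_int_scale (fun u => sin (k / b * u) / (a ^ 2 + sinh u ^ 2) ^ 1)); auto.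
      apply line_int_sin_kernel, hA.
Qed.

(** * Principal branches and the closed formula *)

Lemma Cmod_RtoC_pos (x : R) : 0 < x -> Cmod (RtoC x) = x.
Proof. intro hx. rewrite Cmod_R. apply Rabs_pos_eq. lra. Qed.

Lemma Csqrt_pos (x : R) : 0 < x -> Csqrt (RtoC x) = RtoC (sqrt x).
Proof.
  intro hx. unfold Csqrt. rewrite Cexp_imag. unfold Carg. simpl.
  destruct (Rle_dec 0 0) as [_ | h]; [| lra].
  rewrite Cmod_RtoC_pos by auto. replace (x / x) with 1 by (field; lra).
  rewrite acos_1. replace (0 / 2) with 0 by field. rewrite cos_0, sin_0.
  unfold RtoC, Cmult; simpl. f_equal; ring.
Qed.

Lemma Csqrt_neg (x : R) : 0 < x -> Csqrt (RtoC (- x)) = (Ci * RtoC (sqrt x))%C.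
Proof.
  intro hx. unfold Csqrt. rewrite Cexp_imag. unfold Carg. simpl.
  destruct (Rle_dec 0 0) as [_ | h]; [| lra].
  rewrite Cmod_R, Rabs_Ropp, (Rabs_pos_eq x) by lra.
  replace (- x / x) with (Ropp 1) by (field; lra).
  rewrite acos_opp, acos_1, Rminus_0_r, cos_PI2, sin_PI2.
  unfold RtoC, Ci, Cmult; simpl. f_equal; ring.
Qed.

(** The point [a + i sqrt (1 - a^2)] lies on the unit circle in the upper half
    plane, so its logarithm is [i acos a]. *)
Lemma Cacos_lt_1 (a : R) : 0 < a < 1 -> Cacos (RtoC a) = RtoC (acos a).
Proof.
  intro ha. unfold Cacos. rewrite <- RtoC_mult, <- RtoC_minus, Csqrt_pos by nra.
  replace (RtoC a + Ci * RtoC (sqrt (1 - a * a)))%C with ((a, sqrt (1 - a * a)) : C)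
    by (unfold RtoC, Ci, Cmult, Cplus; simpl; f_equal; ring).
  assert (hm : Cmod (a, sqrt (1 - a * a)) = 1).
  { unfold Cmod. simpl fst. simpl snd. rewrite pow2_sqrt by nra.
    replace (a ^ 2 + (1 - a * a)) with 1 by ring. apply sqrt_1. }
  unfold Clog, Carg. rewrite hm, ln_1. simpl.
  destruct (Rle_dec 0 (sqrt (1 - a * a))) as [_ | h]; [| generalize (sqrt_pos (1 - a * a)); lra].
  rewrite Rdiv_1_r. unfold RtoC, Ci, Cmult, Copp; simpl. f_equal; ring.
Qed.

(** Here [sqrt (1 - a^2) = i sinh eta], so the argument of the logarithm is the
    positive real [cosh eta - sinh eta = exp (- eta)]. *)
Lemma Cacos_gt_1 (eta : R) : 0 < eta -> Cacos (RtoC (cosh eta)) = (Ci * RtoC eta)%C.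
Proof.
  intro heta. assert (hs : 0 < sinh eta) by (rewrite <- sinh_0; apply sinh_lt, heta).
  generalize (cosh_sinh_sqr eta). intro h2.
  unfold Cacos. rewrite <- RtoC_mult, <- RtoC_minus.
  replace (1 - cosh eta * cosh eta) with (- (sinh eta ^ 2)) by (rewrite <- Rsqr_pow2 in *; unfold Rsqr in *; lra).
  rewrite Csqrt_neg, sqrt_pow2 by (try apply pow_lt; lra).
  replace (RtoC (cosh eta) + Ci * (Ci * RtoC (sinh eta)))%C with (RtoC (exp (- eta))).
  2:{ replace (exp (- eta)) with (cosh eta - sinh eta) by (unfold cosh, sinh; lra).
      unfold RtoC, Ci, Cmult, Cplus; simpl; f_equal; ring. }
  unfold Clog, Carg. rewrite Cmod_RtoC_pos by apply exp_pos. rewrite ln_exp. simpl.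
  destruct (Rle_dec 0 0) as [_ | h]; [| lra].
  replace (exp (- eta) / exp (- eta)) with 1 by (field; apply Rgt_not_eq, exp_pos).
  rewrite acos_1. unfold RtoC, Ci, Cmult, Copp; simpl. f_equal; ring.
Qed.

Lemma Csinh_real (x : R) : Csinh (RtoC x) = RtoC (sinh x).
Proof.
  unfold Csinh, Cexp, sinh, RtoC, Cdiv, Cmult, Cminus, Cplus, Copp, Cinv; simpl.
  rewrite Ropp_0, cos_0, sin_0. f_equal; field.
Qed.

Lemma Csinh_imag (x : R) : Csinh (Ci * RtoC x) = (Ci * RtoC (sin x))%C.
Proof.
  unfold Csinh. rewrite Cexp_imag.
  replace (- (Ci * RtoC x))%C with (Ci * RtoC (- x))%C
    by (unfold RtoC, Ci, Cmult, Copp; simpl; f_equal; ring).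
  rewrite Cexp_imag, cos_neg, sin_neg.
  unfold RtoC, Ci, Cdiv, Cmult, Cminus, Cplus, Copp, Cinv; simpl. f_equal; field.
Qed.

Lemma sinh_double (x : R) : sinh (2 * x) = 2 * sinh x * cosh x.
Proof.
  unfold sinh, cosh. replace (- (2 * x)) with (- x + - x) by ring.
  replace (2 * x) with (x + x) by ring. rewrite !exp_plus. field.
Qed.

(** After halving the argument of the hyperbolic sine in the denominator, the
    prefactor of the formula is [pi / (a b sinh (k pi / (2 b)))], which is the
    value [G 1 w 1] up to elementary factors. *)
Lemma ghat_prefactor (a b k : R) : 0 < a -> 0 < b -> k <> 0 ->
  2 * PI * cosh (k * PI / (2 * b)) / (a * b * sinh (k * PI / b))
  = / b * G 1 (k / b) 1 / (k / b * a).
Proof.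
  intros ha hb hk. assert (hpi := PI_RGT_0).
  assert (hw : k / b <> 0).
  { apply Rmult_integral_contrapositive. split; auto. apply Rinv_neq_0_compat. lra. }
  rewrite G1_at_one by auto.
  replace (k / b * (PI / 2)) with (k * PI / (2 * b)) by (field; lra).
  replace (k * PI / b) with (2 * (k * PI / (2 * b))) by (field; lra).
  rewrite sinh_double.
  assert (hx : k * PI / (2 * b) <> 0).
  { apply Rmult_integral_contrapositive. split.
    - apply Rmult_integral_contrapositive. split; lra.
    - apply Rinv_neq_0_compat. lra. }
  generalize (sinh_neq_0 _ hx), (cosh_ge_1 (k * PI / (2 * b))). intros h1 h2.
  field. repeat split; auto; lra.
Qed.

(** The cases [a < 1] and [a > 1] are the trigonometric closed form at
    [th = acos a] and the hyperbolic one at [eta = arcosh a]; in the second case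
    the factor [i] of [sinh (i w eta) = i sin (w eta)] cancels that of
    [sqrt (1 - a^2) = i sinh eta]. *)
Lemma ghat_formula_value (a b k : R) : 0 < a -> a <> 1 -> 0 < b -> k <> 0 ->
  ghat_formula b a k = RtoC (/ b * G 1 (k / b) (a ^ 2)).
Proof.
  intros ha ha1 hb hk. unfold ghat_formula. rewrite ghat_prefactor by auto.
  assert (hw : k / b <> 0).
  { apply Rmult_integral_contrapositive. split; auto. apply Rinv_neq_0_compat. lra. }
  set (w := k / b) in *.
  destruct (Rlt_dec a 1) as [hlt | hge].
  - assert (hth : 0 < acos a < PI / 2).
    { assert (hc : 0 < sin (acos a)) by (rewrite sin_acos by lra; apply sqrt_lt_R0; unfold Rsqr; nra).
      generalize (acos_bound a). intros [h1 h2]. split.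
      - destruct h1 as [h1 | h1]; auto. rewrite <- h1, sin_0 in hc. lra.
      - apply Rnot_le_lt. intro h. apply cos_le_0 in h; [| lra].
        rewrite cos_acos in h; lra. }
    generalize (G1_trigonometric w _ hw hth). rewrite cos_acos, sin_acos by lra. unfold Rsqr. intro hG.
    assert (hs : 0 < sqrt (1 - a * a)) by (apply sqrt_lt_R0; nra).
    rewrite Cacos_lt_1, <- RtoC_mult, Csinh_real by lra.
    rewrite <- RtoC_mult, <- RtoC_minus, Csqrt_pos by nra.
    rewrite <- RtoC_div, <- RtoC_mult by lra. f_equal.
    apply (Rmult_eq_reg_l (b * (sqrt (1 - a * a) * a))).
    2:{ apply Rgt_not_eq. repeat apply Rmult_lt_0_compat; lra. }
    transitivity (sqrt (1 - a * a) * a * G 1 w (a ^ 2)); [rewrite hG |]; field; repeat split; auto; lra.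
  - assert (hgt : 1 < a) by lra.
    set (eta := arcsinh (sqrt (a * a - 1))).
    assert (hs : 0 < sqrt (a * a - 1)) by (apply sqrt_lt_R0; nra).
    assert (hsh : sinh eta = sqrt (a * a - 1)) by apply sinh_arcsinh.
    assert (hch : cosh eta = a).
    { generalize (cosh_sinh_sqr eta), (cosh_ge_1 eta). rewrite hsh, pow2_sqrt by nra.
      intros h1 h2. nra. }
    assert (heta : 0 < eta).
    { destruct (Rlt_dec 0 eta) as [h | h]; auto. exfalso.
      destruct (Rle_lt_or_eq_dec eta 0 ltac:(lra)) as [h1 | h1].
      - apply sinh_lt in h1. rewrite sinh_0 in h1. lra.
      - rewrite h1, sinh_0 in hsh. lra. }
    generalize (G1_hyperbolic w eta hw heta). rewrite hch, hsh. intro hG.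
    rewrite <- hch, Cacos_gt_1, hch by auto.
    replace (RtoC w * (Ci * RtoC eta))%C with (Ci * RtoC (w * eta))%C
      by (rewrite RtoC_mult; ring).
    rewrite Csinh_imag, <- RtoC_mult, <- RtoC_minus.
    replace (1 - a * a) with (- (a * a - 1)) by ring. rewrite Csqrt_neg by nra.
    replace (Ci * RtoC (sin (w * eta)) / (Ci * RtoC (sqrt (a * a - 1))))%C
      with (RtoC (sin (w * eta) / sqrt (a * a - 1))).
    2:{ rewrite RtoC_div by lra. field. split.
        - intro h. apply RtoC_inj in h. lra.
        - intro h. injection h. lra. }
    rewrite <- RtoC_mult. f_equal.
    apply (Rmult_eq_reg_l (b * (sqrt (a * a - 1) * a))).
    2:{ apply Rgt_not_eq. repeat apply Rmult_lt_0_compat; lra. }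
    transitivity (sqrt (a * a - 1) * a * G 1 w (a ^ 2)); [rewrite hG |]; field; repeat split; auto; lra.
Qed.

Theorem mainTheorem2 :
  forall a b k : R, 0 < a -> 0 < b ->
    (k <> 0 -> a <> 1 -> is_fourier (g a b) k (ghat_formula b a k)) /\
    (k = 0 \/ a = 1 ->
       exists l : C,
         filterlim (fun p : R * R => ghat_formula b (fst p) (snd p))
           (within regular (locally ((a, k) : R * R)))
           (locally (l : C)) /\
         is_fourier (g a b) k l).
Proof.
  intros a b k ha hb. split.
  - intros hk ha1. rewrite ghat_formula_value by auto. apply g_fourier; auto.
  - intros _. exists (RtoC (/ b * G 1 (k / b) (a ^ 2))). split; [| apply g_fourier; auto].
    apply filterlim_ext_loc with (fun p => RtoC (/ b * G 1 (snd p / b) (fst p ^ 2))).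
    { unfold within. apply filter_forall. intros [a' k'] [h1 [h2 h3]]. simpl in *.
      symmetry. apply ghat_formula_value; auto. }
    apply (filterlim_filter_le_1 (F := locally ((a, k) : R * R))).
    { intros P HP. unfold within. apply filter_imp with (2 := HP). auto. }
    apply (filterlim_comp _ _ _ (fun p : R * R => / b * G 1 (snd p / b) (fst p ^ 2)) RtoC _
      (locally (/ b * G 1 (k / b) (a ^ 2)))).
    + apply (continuous_scal_r (V := R_NormedModule) (/ b) (fun p : R * R => G 1 (snd p / b) (fst p ^ 2)) (a, k)).
      apply G1_continuous.
      * apply (continuous_scal_l (V := R_NormedModule) (fun p : R * R => snd p) (/ b)). apply continuous_snd.
      * apply (continuous_comp (fun p : R * R => fst p) (fun x => x ^ 2)); [apply continuous_fst |].
        apply (ex_derive_continuous (V := R_NormedModule)). auto_derive. auto.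
      * simpl fst. apply pow_lt, ha.
    + apply filterlim_locally. intros eps. exists eps. intros x hx.
      split; simpl; [exact hx | apply ball_center].
Qed.
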